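(* Fix a finite propositional signature $\sigma$. (1) For every modal formula $\chi$ over $\sigma$ there is an acyclic modal automaton $A_\chi$ for $\sigma$ that accepts precisely the $\sigma$-trees satisfying $\chi$ (at the root). (2) Conversely, for every acyclic modal automaton $A$ for $\sigma$ there is a modal formula $\chi_A$ such that a fat $\sigma$-tree satisfies $\chi_A$ (at the root) iff it is accepted by $A$.
   Context: A $\sigma$-tree is a pointed Kripke model $(M,w)$, $M=(W,R,V)$ over $\sigma$, such that every world $v$ is reached by exactly one directed $R$-path from $w$; it is fat if for each $(v,v')\in R$ there are infinitely many $v''$ with $(v,v'')\in R$ and $(M,v')$, $(M,v'')$ $\sigma$-bisimilar (in the usual sense of bisimulation respecting the letters of $\sigma$). For a world $v$, $\mathrm{lab}_\sigma(v)=\{p\in\sigma\mid v\in V(p)\}$. A modal automaton for $\sigma$ is $A=(\Sigma,Q,\delta,q_0,F)$ with alphabet $\Sigma=2^\sigma$, finite state set $Q$, transition relation $\delta\subseteq Q\times\Sigma\times\wp(Q)$, initial state $q_0\in Q$ and accepting states $F\subseteq Q$. An accepting run of $A$ on a $\sigma$-tree $(M,w)$ is a function $\rho:W\to Q$ with $\rho(w)=q_0$ and such that for every $v$, either $\rho(v)\in F$ or $(\rho(v),\mathrm{lab}_\sigma(v),\{\rho(v')\mid(v,v')\in R\})\in\delta$; $A$ accepts $(M,w)$ if an accepting run exists. $A$ is acyclic if there is $\mathrm{rank}:Q\to\mathbb N$ with $\mathrm{rank}(q')<\mathrm{rank}(q)$ whenever $(q,a,S)\in\delta$ and $q'\in S$.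 *)

(* Defs.v *)
From mathcomp Require Import all_boot.
From mathcomp Require Import boolp classical_sets cardinality.

Set Implicit Arguments.
Unset Strict Implicit.
Unset Printing Implicit Defensive.

Local Open Scope classical_set_scope.

(* [MTop] is primitive so that formulas exist over the empty signature too. *)
Inductive mformula (sigma : Type) : Type :=
| MTop
| MVar of sigma
| MNeg of mformula sigma
| MAnd of mformula sigma & mformula sigma
| MDia of mformula sigma.

Arguments MTop {sigma}.

Record kripke (sigma : Type) : Type := Kripke {
  world :> Type;
  acc : world -> world -> Prop;
  valuation : sigma -> set world
}.

Fixpoint sat (sigma : Type) (M : kripke sigma) (v : M) (chi : mformula sigma)
    : Prop :=
  match chi with
  | MTop => True
  | MVar p => valuation p v
  | MNeg phi => ~ sat v phi
  | MAnd phi psi => sat v phi /\ sat v psi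
  | MDia phi => exists2 v' : M, acc v v' & sat v' phi
  end.

Record bisimulation (sigma : Type) (M N : kripke sigma) (Z : M -> N -> Prop)
    : Prop := Bisimulation {
  bisim_atoms : forall x y, Z x y -> forall p, valuation p x <-> valuation p y;
  bisim_forth : forall x y, Z x y ->
    forall x', acc x x' -> exists2 y', acc y y' & Z x' y';
  bisim_back : forall x y, Z x y ->
    forall y', acc y y' -> exists2 x', acc x x' & Z x' y'
}.

Definition bisimilar (sigma : Type) (M N : kripke sigma) (x : M) (y : N)
    : Prop :=
  exists2 Z : M -> N -> Prop, bisimulation Z & Z x y.

(* A directed path from w to v is given by the sequence s of its worlds after
   w; s may be empty, so the unique path from the root to itself is the trivial
   one. *)
Definition sigma_tree (sigma : Type) (M : kripke sigma) (w : M) : Prop :=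
  forall v : M, exists! s : seq M,
    path (fun x y : M => `[< acc x y >]) w s /\ last w s = v.

Definition fat (sigma : Type) (M : kripke sigma) : Prop :=
  forall v v' : M, acc v v' ->
    infinite_set [set v'' : M | acc v v'' /\ bisimilar v' v''].

Definition lab (sigma : finType) (M : kripke sigma) (v : M) : {set sigma} :=
  [set p | v \in valuation p]%SET.

Record modal_automaton (sigma : finType) : Type := ModalAutomaton {
  state : finType;
  delta : {set state * {set sigma} * {set state}};
  init : state;
  final : {set state}
}.

Definition accepting_run (sigma : finType) (A : modal_automaton sigma)
    (M : kripke sigma) (w : M) (rho : M -> state A) : Prop :=
  rho w = init A /\
  forall v : M,
    rho v \in final A \/
    (rho v, lab v, [set q | q \in rho @` [set v' | acc v v']]%SET) \in delta A.

Definition accepts (sigma : finType) (A : modal_automaton sigma)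
    (M : kripke sigma) (w : M) : Prop :=
  exists rho : M -> state A, accepting_run w rho.

Definition acyclic (sigma : finType) (A : modal_automaton sigma) : Prop :=
  exists rank : state A -> nat,
    forall (q : state A) (a : {set sigma}) (S : {set state A}),
      (q, a, S) \in delta A -> forall q', q' \in S -> rank q' < rank q.

(* Main.v *)
Require Import Defs.
From mathcomp Require Import all_boot.
From mathcomp Require Import boolp classical_sets cardinality.

(** On a tree, a run can be assembled top-down from local choices, so that
    acceptance by an acyclic automaton amounts to an inductively defined
    predicate [win q v] on states and worlds.  For (1), the states are the
    finitely many k-types (the label together with the set of (k-1)-types of the
    successors), which determine the truth of formulas of modal depth < k.  For
    (2), [win q] is expressed by recursion on the rank of [q]; in a fat model
    each state of a transition (q, a, S) is realised by infinitely many
    successors, so distinct successors can be assigned to the states in S. *)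

Set Implicit Arguments.
Unset Strict Implicit.
Unset Printing Implicit Defensive.

Local Open Scope classical_set_scope.

(** * Accepting runs as local winning choices *)

Section Win.
Variables (sigma : finType) (A : modal_automaton sigma) (M : kripke sigma).

Definition succ_states (v : M) (f : M -> state A) : {set state A} :=
  [set q | q \in f @` [set v' | acc v v']]%SET.

Lemma succ_statesP (v : M) (f : M -> state A) q :
  reflect (exists2 v', acc v v' & f v' = q) (q \in succ_states v f).
Proof. by rewrite inE; apply: (iffP idP); rewrite in_setE. Qed.

(** Each step picks its own [f], of which only the values on the successors of [v] matter. *)
Inductive win : state A -> M -> Prop :=
| WinFinal q v : q \in final A -> win q v
| WinStep q v f : (q, lab v, succ_states v f) \in delta A ->
    (forall v', acc v v' -> win (f v') v') -> win q v.

Lemma winE q v : win q v <->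
  q \in final A \/
  exists2 f, (q, lab v, succ_states v f) \in delta A &
    forall v', acc v v' -> win (f v') v'.
Proof.
split=> [qv|]; first by case: q v / qv => [q v|q v f]; [left | right; exists f].
by case=> [|[f]]; [exact: WinFinal | exact: WinStep].
Qed.

(** The unique path from the root to a world fixes the order in which local choices are composed, so
    every world receives exactly one state. *)
Lemma win_accepts (w : M) : sigma_tree w -> win (init A) w -> accepts A w.
Proof.
move=> treew win_w.
(* Choices are fixed in advance for every pair of a state and a world. At an accepting state all
   successors inherit that state; where [win] fails, the constant value is arbitrary. *)
have /choice [g gP] (qv : state A * M) : exists g : M -> state A,
    win qv.1 qv.2 ->
    (forall v', acc qv.2 v' -> win (g v') v') /\
    (qv.1 \in final A \/ (qv.1, lab qv.2, succ_states qv.2 g) \in delta A).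
  case: qv => q v /=.
  case: (pselect (win q v)) => [/winE [qF|[f qf fP]]|nwin].
  - by exists (fun=> q) => _; split; [move=> *; exact: WinFinal | left].
  - by exists f => _; split; [| right].
  - by exists (fun=> q).
have /choice [s sP] := treew.
(* [run q v p] is the state reached at the end of the path [p] when starting at [v] in state [q]. *)
pose fix run q v p := if p is x :: p' then run (g (q, v) x) x p' else q.
have run_rcons q v p x :
    run q v (rcons p x) = g (run q v p, last v p) x.
  by elim: p q v => [|y p IHp] q v //=; rewrite IHp.
pose rho v := run (init A) w (s v).
have s_w : s w = [::] by have [_] := sP w; apply.
have s_succ v v' : acc v v' -> s v' = rcons (s v) v'.
  move=> vv'; have [[pv lv] _] := sP v; have [_] := sP v'; apply.
  by rewrite rcons_path pv lv last_rcons; split=> //=; apply/asboolP.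
have rho_succ v v' : acc v v' -> rho v' = g (rho v, v) v'.
  by move=> vv'; rewrite /rho (s_succ _ _ vv') run_rcons; have [[_ ->] _] := sP v.
have win_rho v : win (rho v) v.
  rewrite /rho; have [[]] := sP v; move: (s v) => p + <- _.
  elim/last_ind: p => [//|p x IHp]; rewrite rcons_path => /andP[pp /asboolP ax].
  rewrite run_rcons last_rcons.
  by apply: (gP (_, _) _).1 ax; apply: IHp.
exists rho; split; first by rewrite /rho s_w.
move=> v; have [_ [|stepv]] := gP (_, _) (win_rho v); [by left | right].
suff -> : [set q | q \in rho @` [set v' | acc v v']]%SET =
    succ_states v (g (rho v, v)) by [].
apply/setP => q; apply/succ_statesP/succ_statesP => -[v' vv' <-];
  by exists v' => //; rewrite (rho_succ _ _ vv').
Qed.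

(** The induction is on the rank of the state at [w], since the model may have infinite paths: each
    transition lowers the rank. *)
Lemma accepts_win (w : M) : acyclic A -> accepts A w -> win (init A) w.
Proof.
move=> [rank rankP] [rho [<- rhoP]].
have [n] := ubnP (rank (rho w)); elim: n w => // n IHn w ltn.
have [wF|stepw] := rhoP w; first exact: WinFinal.
apply: (WinStep stepw) => v' wv'; apply: IHn.
apply: (@leq_trans (rank (rho w))) => //.
by apply: rankP stepw _ _; apply/succ_statesP; exists v'.
Qed.

Lemma accepts_iff_win (w : M) :
  acyclic A -> sigma_tree w -> accepts A w <-> win (init A) w.
Proof. by move=> ? ?; split; [exact: accepts_win | exact: win_accepts]. Qed.

End Win.

(** * Types of bounded depth and the automaton of a formula *)

Section Types.
Variable sigma : finType.

Fixpoint mdepth (phi : mformula sigma) : nat :=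
  match phi with
  | MTop | MVar _ => 0
  | MNeg phi => mdepth phi
  | MAnd phi psi => maxn (mdepth phi) (mdepth psi)
  | MDia phi => (mdepth phi).+1
  end.

(** Level 0 is trivial and labels are seen only from level 1 on; hence the strict bound in
    [sat_tp]. *)
Fixpoint ktype (k : nat) : finType :=
  if k is k'.+1 then ({set sigma} * {set ktype k'})%type else unit.

Fixpoint tp (M : kripke sigma) (k : nat) (v : M) : ktype k :=
  if k is k'.+1 return ktype k then
    (lab v, [set t | `[< exists2 v', acc v v' & tp k' v' = t >]]%SET)
  else tt.

Lemma succ_tpP (M : kripke sigma) k (v : M) t :
  reflect (exists2 v', acc v v' & tp k v' = t) (t \in (tp k.+1 v).2).
Proof. by rewrite inE; apply: asboolP. Qed.

(** For a diamond, equality of the sets of successor types yields a successor of the same type on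
    the other side. The models may differ because [root_step] takes its witness from an arbitrary
    model. *)
Lemma sat_tp phi k (M N : kripke sigma) (v : M) (u : N) :
  mdepth phi < k -> tp k v = tp k u -> sat v phi <-> sat u phi.
Proof.
elim: phi k M N v u => [|p|phi IH|phi IH1 psi IH2|phi IH] [|k] M N v u //= ltk E.
- case: E => /setP/(_ p); rewrite !inE => E _.
  by split; rewrite -[X in X -> _]in_setE -[X in _ -> X]in_setE E.
- by have := IH k.+1 M N v u ltk E; tauto.
- move: ltk; rewrite gtn_max => /andP[lt1 lt2].
  have := IH1 k.+1 M N v u lt1 E; have := IH2 k.+1 M N v u lt2 E; tauto.
- have {}E := congr1 snd E; split=> -[x ax sx].
  + have /succ_tpP[y ay /esym Exy] : tp k x \in (tp k.+1 u).2.
      by rewrite -E; apply/succ_tpP; exists x.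
    by exists y => //; apply/(IH k M N x y).
  + have /succ_tpP[y ay /esym Exy] : tp k x \in (tp k.+1 v).2.
      by rewrite E; apply/succ_tpP; exists x.
    by exists y => //; apply/(IH k N M x y).
Qed.

(** When [e t] wins exactly at the worlds of type [t], a winning labelling with values in [e @: S]
    must give each successor the code of its own type, so its set of states determines [S]. *)
Lemma win_succ_tp (A : modal_automaton sigma) (M : kripke sigma) k
    (e : ktype k -> state A) (v : M) (S : {set ktype k}) :
  (forall t (v' : M), win (e t) v' <-> tp k v' = t) ->
  (exists2 f, succ_states v f = (e @: S)%SET &
     forall v', acc v v' -> win (f v') v') <->
  S = (tp k.+1 v).2.
Proof.
move=> eP; split=> [[f fS fP]|->].
  apply/setP=> t; apply/idP/succ_tpP => [tS|[v' vv' <-]].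
    have /succ_statesP[v' vv' fv'] : e t \in succ_states v f.
      by rewrite fS imset_f.
    by exists v' => //; apply/eP; rewrite -fv'; apply: fP.
  have : f v' \in succ_states v f by apply/succ_statesP; exists v'.
  rewrite fS => /imsetP[t' tS ft].
  by have := fP v' vv'; rewrite ft => /eP ->.
exists (fun v' => e (tp k v')) => [|v' _]; last exact/eP.
apply/setP=> q; apply/succ_statesP/imsetP => [[v' vv' <-]|[t]].
  by exists (tp k v') => //; apply/succ_tpP; exists v'.
by move=> /succ_tpP[v' vv' <-] ->; exists v'.
Qed.

Section TypeAutomaton.
Variable chi : mformula sigma.
Let n := mdepth chi.

(** [None] is a separate initial state: the root tests [chi], whereas the other states only verify a
    type. *)
Definition tstate : finType := option {i : 'I_n.+1 & ktype i}.

Definition tinj k (ltk : k < n.+1) (t : ktype k) : tstate :=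
  Some (existT (fun i : 'I_n.+1 => ktype i) (Ordinal ltk) t).

Lemma tinj_inj k (ltk ltk' : k < n.+1) t t' :
  tinj ltk t = tinj ltk' t' -> t = t'.
Proof.
rewrite (bool_irrelevance ltk' ltk) => /Some_inj.
exact: (@eq_from_Tagged _ (fun i : 'I_n.+1 => ktype i) (Ordinal ltk)).
Qed.

(** By [sat_tp], a single model of [chi] of a given type vouches for all worlds of that type. *)
Definition root_step (a : {set sigma}) (S : {set tstate}) : Prop :=
  exists2 S0 : {set ktype n}, S = (tinj (ltnSn n) @: S0)%SET &
    exists (M : kripke sigma) (v : M), tp n.+1 v = (a, S0) /\ sat v chi.

Definition type_step (q : tstate) (a : {set sigma}) (S : {set tstate}) : Prop :=
  exists k (ltk1 : k.+1 < n.+1) (ltk : k < n.+1) (S0 : {set ktype k}),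
    q = tinj ltk1 ((a, S0) : ktype k.+1) /\ S = (tinj ltk @: S0)%SET.

(** The unique 0-type imposes no condition, so it is the accepting state. *)
Definition type_automaton : modal_automaton sigma :=
  @ModalAutomaton sigma tstate
    [set x | `[< x.1.1 = None /\ root_step x.1.2 x.2 \/
                 type_step x.1.1 x.1.2 x.2 >]]%SET
    None [set tinj (ltn0Sn n) tt]%SET.

Lemma acyclic_type_automaton : acyclic type_automaton.
Proof.
exists (fun q : tstate => if q is Some u then val (tag u) else n.+1).
move=> q a S; rewrite inE => /asboolP /= [[-> [S0 -> _]]|].
  by move=> _ /imsetP[t _ ->] /=.
by move=> [k [ltk1 [ltk [S0 [-> ->]]]]] _ /imsetP[t _ ->] /=.
Qed.

Lemma win_tinj (M : kripke sigma) k (ltk : k < n.+1) (t : ktype k) (v : M) :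
  @win sigma type_automaton M (tinj ltk t) v <-> tp k v = t.
Proof.
elim: k ltk t v => [|k IHk] ltk t v.
  case: t; split=> // _; apply: WinFinal.
  by rewrite inE (bool_irrelevance ltk (ltn0Sn n)).
have ltk' := ltnW ltk.
have succP := win_succ_tp (A := type_automaton) v _ (IHk ltk').
case: t => a S; split=> [/winE [|[f]]|].
- by rewrite inE => /eqP [].
- rewrite inE => /asboolP /= [[]//|[k' [ltk1 [ltk0 [S0 [E fS]]]]]] fP.
  have Ek : k = k' by case: E.
  subst k'; case: (tinj_inj E) => -> ->.
  rewrite (bool_irrelevance ltk0 ltk') in fS.
  by have /(succP S0) -> : exists2 f, succ_states (A := type_automaton) v f
    = (tinj ltk' @: S0)%SET & forall v', acc v v' -> win (f v') v' by exists f.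
- move=> [<- /esym/succP [f fS fP]].
  apply: (WinStep (f := f)) => //; rewrite inE; apply/asboolP; right => /=.
  by exists k, ltk, ltk', S.
Qed.

Lemma win_type_automaton (M : kripke sigma) (w : M) :
  @win sigma type_automaton M None w <-> sat w chi.
Proof.
have succP := win_succ_tp (A := type_automaton) w _ (@win_tinj M n (ltnSn n)).
split=> [/winE [|[f]]|sw].
- by rewrite inE.
- rewrite inE => /asboolP /= [[_ [S0 fS [N [v [Ev sv]]]]] fP|]; last first.
    by move=> [k [? [? [? []]]]].
  apply/(@sat_tp chi n.+1 M N w v) => //.
  by rewrite Ev; congr (_, _); apply/esym/succP; exists f.
- have [f fS fP] := (succP _).2 erefl.
  apply: (WinStep (f := f)) => //; rewrite inE; apply/asboolP; left => /=.
  by split=> //; exists (tp n.+1 w).2 => //; exists M, w.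
Qed.

End TypeAutomaton.
End Types.

(** * Formulas for acyclic automata on fat models *)

Section Formulas.
Variable sigma : finType.
Implicit Types (M : kripke sigma) (phi psi : mformula sigma).

Definition MBigAnd (I : finType) (P : pred I) (F : I -> mformula sigma) :=
  foldr (fun i => MAnd (F i)) MTop (enum P).

Definition MBigOr (I : finType) (P : pred I) (F : I -> mformula sigma) :=
  MNeg (MBigAnd P (fun i => MNeg (F i))).

Definition MBox phi := MNeg (MDia (MNeg phi)).

Definition MLab (a : {set sigma}) :=
  MBigAnd predT (fun p => if p \in a then MVar p else MNeg (MVar p)).

Lemma sat_MBigAnd (I : finType) (P : pred I) (F : I -> mformula sigma) M (v : M) :
  sat v (MBigAnd P F) <-> forall i, P i -> sat v (F i).
Proof.
suff E (s : seq I) : sat v (foldr (fun i => MAnd (F i)) MTop s) <->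
    forall i, i \in s -> sat v (F i).
  rewrite /MBigAnd E; split=> H i; last by rewrite mem_enum; apply: H.
  by move=> Pi; apply: H; rewrite mem_enum.
elim: s => [|i s [IH1 IH2]] //=; split=> [[si ss] j|H].
  by rewrite inE => /predU1P[->//|]; apply: IH1.
by split; [apply: H; rewrite mem_head | apply: IH2 => j js; apply: H; rewrite inE js orbT].
Qed.

Lemma sat_MBigOr (I : finType) (P : pred I) (F : I -> mformula sigma) M (v : M) :
  sat v (MBigOr P F) <-> exists2 i, P i & sat v (F i).
Proof.
rewrite /MBigOr /= sat_MBigAnd; split=> [H|[i Pi si] H]; last exact: (H i).
by apply: contrapT => nex; apply: H => i Pi /= si; apply: nex; exists i.
Qed.

Lemma sat_MBox phi M (v : M) :
  sat v (MBox phi) <-> forall v', acc v v' -> sat v' phi.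
Proof.
split=> [H v' vv'|H [v' vv' nv']]; last exact/nv'/H.
by apply: contrapT => nphi; apply: H; exists v'.
Qed.

Lemma sat_MLab a M (v : M) : sat v (MLab a) <-> lab v = a.
Proof.
rewrite sat_MBigAnd; split=> [H|<- p _].
  apply/setP=> p; have := H p isT; rewrite inE.
  by case: (p \in a) => /= vp; [apply/mem_set | apply/negP; rewrite in_setE].
by rewrite inE; case: ifPn => [|/negP] /=; rewrite in_setE.
Qed.

Lemma sat_bisimilar phi M (N : kripke sigma) (v : M) (u : N) :
  bisimilar v u -> sat v phi <-> sat u phi.
Proof.
move=> [Z [atoms forth back]].
elim: phi v u => [|p|phi IH|phi IH1 psi IH2|phi IH] v u Zvu //=.
- exact: atoms.
- by have := IH _ _ Zvu; tauto.
- by have := IH1 _ _ Zvu; have := IH2 _ _ Zvu; tauto.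
- split=> -[x ax sx].
    by have [y ay Zxy] := forth _ _ Zvu _ ax; exists y => //; apply/(IH x).
  by have [y ay Zxy] := back _ _ Zvu _ ax; exists y => //; apply/(IH _ x).
Qed.

Variable A : modal_automaton sigma.

(** The fuel [n] is meant to exceed the rank of [q]. The conjuncts after the label form the cover
    modality of [x.2]. *)
Fixpoint win_formula (n : nat) (q : state A) : mformula sigma :=
  if q \in final A then MTop else
  if n is n'.+1 then
    MBigOr [pred x : {set sigma} * {set state A} | (q, x.1, x.2) \in delta A]
      (fun x => MAnd (MLab x.1)
        (MAnd (MBigAnd (mem x.2) (fun q' => MDia (win_formula n' q')))
              (MBox (MBigOr (mem x.2) (win_formula n')))))
  else MNeg MTop.

End Formulas.

(** Indices are treated one at a time: only finitely many values are already taken, and [X i] is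
    infinite. The point [t0] serves the empty list. *)
Lemma distinct_representatives (I : eqType) (T : Type) (s : seq I)
    (X : I -> set T) (t0 : T) :
  (forall i, i \in s -> infinite_set (X i)) ->
  exists2 g : I -> T, forall i, i \in s -> X i (g i) & {in s &, injective g}.
Proof.
elim: s => [|i s IHs] infX; first by exists (fun=> t0).
have [j js|g gX g_inj] := IHs; first by apply: infX; rewrite inE js orbT.
have [i_s|i_s] := boolP (i \in s).
  have sE : i :: s =i s by move=> j; rewrite inE; case: eqP => [->|].
  by exists g => [j|j k]; rewrite !sE; [apply: gX | apply: g_inj].
have [x Xx gx] : exists2 x, X i x & ~ (g @` [set` s]) x.
  apply: contrapT => nex; apply: (infX i (mem_head _ _)).
  apply: (@sub_finite_set _ _ (g @` [set` s])); last exact/finite_image/finite_seq.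
  by move=> x Xx; apply: contrapT => gx; apply: nex; exists x.
exists (fun j => if j == i then x else g j) => [j|j k].
  by rewrite inE; case: eqP => [->|_] //=; apply: gX.
rewrite !inE; case: eqP => [->|_]; case: eqP => [->|_] //= js ks.
- by move=> E; case: gx; exists k.
- by move=> E; case: gx; exists j.
- exact: g_inj.
Qed.

(** The delicate direction is from formula to [win]: one successor may witness several diamonds, but
    [f] gives it a single state. Fatness supplies enough witnesses. *)
Lemma sat_win_formula (sigma : finType) (A : modal_automaton sigma)
    (rank : state A -> nat) (M : kripke sigma) :
  (forall q a S, (q, a, S) \in delta A ->
     forall q', q' \in S -> rank q' < rank q) ->
  fat M -> forall n q (v : M), rank q < n ->
  sat v (win_formula n q) <-> win q v.
Proof.
move=> rankP fatM; elim=> // n IHn q v ltq /=.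
case: ifPn => [qF|qF]; first by split=> // _; apply: WinFinal.
rewrite sat_MBigOr; split.
  move=> [[a S] /= qaS [/sat_MLab Ea [/sat_MBigAnd Sex Sbox]]]; subst a.
  have Sall := (sat_MBox (MBigOr (mem S) (win_formula n)) v).1 Sbox.
  have ltS q' : q' \in S -> rank q' < n.
    by move=> /(rankP _ _ _ qaS) lt; apply: leq_trans lt _.
  (* Bisimilar copies of a diamond witness satisfy the same formula, so they win from [q'] too. *)
  have infX q' : q' \in enum S ->
      infinite_set [set v' | acc v v' /\ win q' v'].
    rewrite mem_enum => q'S; have [v' vv' sv'] := Sex q' q'S.
    apply: sub_infinite_set (fatM _ _ vv') => u [vu bis]; split=> //.
    by apply/(IHn _ _ (ltS _ q'S)); apply/(sat_bisimilar _ bis).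
  have [g gX g_inj] := distinct_representatives v infX.
  (* A representative gets the state it represents, any other successor a state provided by the box,
     and the remaining worlds the dummy value [q]. *)
  have /choice [f fP] (v' : M) : exists q', (acc v v' -> q' \in S /\ win q' v') /\
      (forall q'', q'' \in S -> g q'' = v' -> q' = q'').
    case: (pselect (exists2 q', q' \in S & g q' = v')) => [[q' q'S gq']|nex].
      exists q'; split=> [_|q'' q''S gq''].
        by split=> //; have := gX q'; rewrite mem_enum gq' => /(_ q'S) [].
      by apply: g_inj; rewrite ?mem_enum // gq' gq''.
    have none q' q'' : q'' \in S -> g q'' = v' -> q' = q''.
      by move=> q''S gq''; case: nex; exists q''.
    case: (pselect (acc v v')) => [vv'|nacc]; last first.
      by exists q; split=> [//|]; apply: none.
    have /sat_MBigOr [q' /= q'S sq'] := Sall _ vv'.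
    exists q'; split=> [_|]; last exact: none.
    by split=> //; apply/(IHn _ _ (ltS _ q'S)).
  apply: (WinStep (f := f)) => [|v' vv']; last by have [] := (fP v').1 vv'.
  suff -> : succ_states v f = S by [].
  apply/setP=> q'; apply/succ_statesP/idP => [[v' vv' <-]|q'S].
    by have [] := (fP v').1 vv'.
  have [vg _] : acc v (g q') /\ win q' (g q') by apply: gX; rewrite mem_enum.
  by exists (g q') => //; apply: (fP (g q')).2.
move=> /winE [qF'|[f qf fP]]; first by rewrite qF' in qF.
have sat_f v' : acc v v' -> sat v' (win_formula n (f v')).
  move=> vv'; apply/IHn; last exact: fP.
  apply: leq_trans (_ : rank q <= n) => //.
  by apply: rankP qf _ _; apply/succ_statesP; exists v'.
exists (lab v, succ_states v f) => //=; split; first exact/sat_MLab.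
split; first by apply/sat_MBigAnd => q' /succ_statesP[v' vv' <-]; exists v'; auto.
apply: (sat_MBox (MBigOr (mem (succ_states v f)) (win_formula n)) v).2 => v' vv'.
apply/sat_MBigOr; exists (f v'); last exact: sat_f.
by apply/succ_statesP; exists v'.
Qed.

Theorem theorem30 (sigma : finType) :
  (forall chi : mformula sigma,
     exists A : modal_automaton sigma,
       acyclic A /\
       forall (M : kripke sigma) (w : M), sigma_tree w ->
         (accepts A w <-> sat w chi))
  /\
  (forall A : modal_automaton sigma, acyclic A ->
     exists chi : mformula sigma,
       forall (M : kripke sigma) (w : M), sigma_tree w -> fat M ->
         (sat w chi <-> accepts A w)).
Proof.
split=> [chi|A acycA].
  exists (type_automaton chi); split=> [|M w treew].
    exact: acyclic_type_automaton.
  rewrite accepts_iff_win //; last exact: acyclic_type_automaton.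
  exact: win_type_automaton.
have [rank rankP] := acycA.
(* The successor makes the fuel strictly larger than the rank of the initial state. *)
exists (win_formula (rank (init A)).+1 (init A)) => M w treew fatM.
by rewrite (sat_win_formula rankP) // accepts_iff_win.
Qed.
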